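(* Consider the stopped-mass game, in which the payoff of player $i\in[N]$ under a pure stopping profile $\tau\in\mathcal T^N$ is $$J_i(\tau)=\mathbb E\Big[h_i\big(X_{\tau^i},\tau^i,(\mathbf 1_{\{\tau^j\le\tau^i\}})_{j\ne i}\big)\Big],$$ with $h_i:\mathbb R^d\times[0,\infty)\times\{0,1\}^{N-1}\to\mathbb R$ measurable. For $q^{-i}=(q^j)_{j\ne i}\in[0,1]^{N-1}$ let $$g_i^N(x,t,q^{-i}):=\sum_{a^{-i}\in\{0,1\}^{N-1}}h_i(x,t,a^{-i})\prod_{j\ne i}(q^j)^{a^j}(1-q^j)^{1-a^j}.$$ Then for every $p\in\mathcal R^N$ and $i\in[N]$ the canonical randomized payoff $J_i^R(p)$ admits the local representation $$J_i^R(p)=\mathbb E\Big[\int_{[0,\infty)}g_i^N(X_t,t,p_t^{-i})\,dp_t^i\Big].$$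
   Context: Fix $N\ge 2$ and $[N]=\{1,\dots,N\}$. $(\Omega,\mathcal F,\mathbb F,\mathbb P)$ is a filtered probability space satisfying the usual conditions, where $\mathbb F=(\mathcal F_t)_{t\ge 0}$ is generated by a continuous $\mathbb R^d$-valued process $X=(X_t)_{t\ge0}$. $\mathcal T$ is the set of $\mathbb F$-stopping times $\tau:\Omega\to[0,\infty)$. Standing integrability assumption: $\sup_{\tau\in\mathcal T^N}\mathbb E\big[|h_i(X_{\tau^i},\tau^i,(\mathbf 1_{\{\tau^j\le\tau^i\}})_{j\ne i})|\big]<\infty$ for each $i$. $\mathcal R$ is the set of processes $p:[0,\infty)\times\Omega\to[0,1]$ that are $\mathbb F$-adapted, càdlàg, nondecreasing, with $p_{0-}=0$ and $p_\infty=\lim_{t\to\infty}p_t=1$; $p_t^{-i}=(p_t^j)_{j\neq i}$. For $p\in\mathcal R^N$, $\Theta^{i,p^i}(\omega,u_i):=\inf\{t\ge0:p^i_t(\omega)>u_i\}$, $u_i\in[0,1]$ (the convention at $u_i=1$ is immaterial). The canonical (independently) randomized payoff is $$J_i^R(p):=\int_{[0,1]^N}J_i\big(\Theta^{1,p^1}(\cdot,u_1),\dots,\Theta^{N,p^N}(\cdot,u_N)\big)\,du_1\cdots du_N,$$ i.e. the expectation under $\mathbb P\otimes\mathrm{Leb}^{\otimes N}$ of the payoff at the stopping profile $(\Theta^{i,p^i}(\cdot,U^i))_i$ with $U^1,\dots,U^N$ i.i.d. uniform on $[0,1]$ and independent of $\mathcal F$. The integral $\int_{[0,\infty)}\cdot\,dp^i_t$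 is a Lebesgue–Stieltjes integral that includes the possible atom of mass $p_0^i-p_{0-}^i=p_0^i$ at $t=0$. Convention: $0^0=1$. *)

(* Defs.v *)
From HB Require Import structures.
From mathcomp Require Import all_boot all_order all_algebra.
From mathcomp Require Import all_classical all_reals all_analysis.

Set Implicit Arguments.
Unset Strict Implicit.
Unset Printing Implicit Defensive.
Import Order.TTheory GRing.Theory Num.Theory.
Import numFieldNormedType.Exports.

Local Open Scope classical_set_scope.
Local Open Scope ring_scope.

(* R^n is n.-tuple (measurableTypeR R): tuples carry the product sigma-algebra
   of the Borel sigma-algebra of R, i.e. the Borel sigma-algebra of R^n. *)

Section cons_measure.
Context (R : realType) (d : measure_display) (T : measurableType d) (n : nat).
Variables (m1 : {sigma_finite_measure set T -> \bar R})
          (m2 : {sigma_finite_measure set (n.-tuple T) -> \bar R}).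

Definition tcons (z : T * n.-tuple T) : n.+1.-tuple T :=
  [the n.+1.-tuple T of z.1 :: z.2].

Lemma measurable_tcons : measurable_fun setT tcons.
Proof. exact: measurable_cons. Qed.

(* The product of m1 and m2 transported along T x T^n = T^(n+1). *)
Definition cons_measure : set (n.+1.-tuple T) -> \bar R :=
  pushforward (m1 \x m2)%E tcons.

Let cm0 : cons_measure set0 = 0%E.
Proof. by rewrite /cons_measure /pushforward preimage_set0 measure0. Qed.

Let cm_ge0 A : (0 <= cons_measure A)%E.
Proof. by apply: integral_ge0 => // *; exact: measure_ge0. Qed.

Let cm_sigma_additive : semi_sigma_additive cons_measure.
Proof.
move=> F mF tF mUF; rewrite /cons_measure /pushforward preimage_bigcup.
apply: measure_semi_sigma_additive.
- by move=> k; rewrite -[X in measurable X]setTI; exact: measurable_tcons.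
- apply/trivIsetP => /= i j _ _ ij; rewrite -preimage_setI.
  by move/trivIsetP : tF => /(_ _ _ _ _ ij) ->//; rewrite preimage_set0.
- by rewrite -preimage_bigcup -[X in measurable X]setTI; exact: measurable_tcons.
Qed.

HB.instance Definition _ := isMeasure.Build _ _ _
  cons_measure cm0 cm_ge0 cm_sigma_additive.

Lemma cons_measureE (A : set T) (B : set (n.-tuple T)) :
  measurable A -> measurable B ->
  cons_measure [set t | A (thead t) /\ B [tuple of behead t]]
  = (m1 A * m2 B)%E.
Proof.
move=> mA mB; rewrite -product_measure1E// /cons_measure /pushforward.
congr (product_measure1 _ _ _); apply/seteqP; split=> -[x t] /=.
- by rewrite theadE => -[Ax Bt]; split=> //=; move: Bt; congr (B _); exact: val_inj.
- by case=> /= Ax Bt; rewrite theadE; split=> //; move: Bt; congr (B _); exact: val_inj.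
Qed.

Let cm_sigma_finite : sigma_finite setT cons_measure.
Proof.
have /sigma_finiteP[F [UF ndF Foo]] := sigma_finiteT m1.
have /sigma_finiteP[G [UG ndG Goo]] := sigma_finiteT m2.
exists (fun k => [set t | F k (thead t) /\ G k [tuple of behead t]]).
  apply/esym; rewrite -subTset => t _.
  have [i _ Fi] : (\bigcup_i F i) (thead t) by rewrite -UF.
  have [j _ Gj] : (\bigcup_i G i) [tuple of behead t] by rewrite -UG.
  exists (maxn i j) => //; split.
  - by move: Fi; apply/subsetPset/ndF; rewrite leq_maxl.
  - by move: Gj; apply/subsetPset/ndG; rewrite leq_maxr.
move=> k; have [mF Fk] := Foo k; have [mG Gk] := Goo k; split.
  apply: measurableI; rewrite -[X in measurable X]setTI.
  - exact: (measurable_tnth ord0).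
  - exact: measurable_behead.
by rewrite cons_measureE// lte_mul_pinfty// ge0_fin_numE.
Qed.

HB.instance Definition _ := Measure_isSigmaFinite.Build _ _ _
  cons_measure cm_sigma_finite.

End cons_measure.

Fixpoint lebesgue_measure_tuple (R : realType) (n : nat) :
    {sigma_finite_measure set (n.-tuple (measurableTypeR R)) -> \bar R} :=
  match n with
  | 0 => dirac [tuple]
  | n'.+1 => cons_measure (@lebesgue_measure R) (lebesgue_measure_tuple R n')
  end.

Definition unit_cube (R : realType) (n : nat) :
    set (n.-tuple (measurableTypeR R)) :=
  [set u | forall k, 0 <= tnth u k <= 1].

Section filtration.
Context (R : realType) (d0 : measure_display) (Omega : measurableType d0).
Variable (P : probability Omega R).
Implicit Types (F : R -> set (set Omega)) (t s r : R).

(* Time is [0, +oo); a family indexed by R is only constrained, and only used,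
   at nonnegative indices. *)
Record filtration F : Prop := Filtration {
  filtration_sigma : forall t, 0 <= t -> sigma_algebra setT (F t) ;
  filtration_sub : forall t, 0 <= t -> F t `<=` measurable ;
  filtration_nd : forall s t, 0 <= s -> s <= t -> F s `<=` F t }.

(* Since F 0 consists of measurable sets, null_in_F0 entails that P is
   complete. *)
Record usual_conditions F : Prop := UsualConditions {
  usual_filtration : filtration F ;
  null_in_F0 : P.-negligible `<=` F 0 ;
  right_continuous_filtration :
    forall t, 0 <= t -> F t = \bigcap_(s in `]t, +oo[) F s }.

Section generated.
Context (d1 : measure_display) (E : measurableType d1).
Variable (X : R -> Omega -> E).

Definition process_events t : set (set Omega) :=
  [set A | exists s (B : set E),
     [/\ 0 <= s <= t, measurable B & A = X s @^-1` B]].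

(* The usual augmentation of the natural filtration sigma(X_s, s <= t): the
   smallest filtration to which X is adapted and which satisfies the usual
   conditions. It is the natural filtration itself when that one already
   satisfies them. *)
Definition augmented_natural_filtration t : set (set Omega) :=
  \bigcap_(s in `]t, +oo[) <<s process_events s `|` P.-negligible >>.

Definition generated_by F :=
  forall t, 0 <= t -> F t = augmented_natural_filtration t.

End generated.

Definition stopping_time F (tau : Omega -> R) :=
  (forall w, 0 <= tau w) /\
  (forall t, 0 <= t -> F t [set w | tau w <= t]).

(* The class \mathcal{R} of randomized stopping strategies. *)
Record randomized_stopping F := RandomizedStopping {
  rs_fun :> R -> Omega -> R ;
  rs_range : forall t w, 0 <= t -> 0 <= rs_fun t w <= 1 ;
  rs_adapted : forall t (B : set (measurableTypeR R)),
    0 <= t -> measurable B -> F t (rs_fun t @^-1` B) ;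
  rs_right_continuous : forall w t, 0 <= t ->
    rs_fun s w @[s --> t^'+] --> rs_fun t w ;
  rs_left_limits : forall w t, 0 < t -> cvg (rs_fun s w @[s --> t^'-]) ;
  rs_nondecreasing : forall w s t, 0 <= s -> s <= t ->
    rs_fun s w <= rs_fun t w ;
  rs_limit : forall w, rs_fun t w @[t --> +oo] --> (1 : R) }.

(* The path of p extended by p_{0-} = 0 to negative times, so that its
   Lebesgue-Stieltjes measure has an atom of mass p_0 at 0. *)
Definition rs_path F (p : randomized_stopping F) (w : Omega) : R -> R :=
  fun t => if 0 <= t then p t w else 0.

Section rs_path_cumulative.
Variables (F : R -> set (set Omega)) (p : randomized_stopping F) (w : Omega).

Let rs_path_nondecreasing : nondecreasing (rs_path p w).
Proof.
move=> s t st; rewrite /rs_path; case: ifPn => [s0|_].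
  by rewrite (le_trans s0 st) rs_nondecreasing.
by case: ifPn => // t0; have /andP[] := rs_range p w t0.
Qed.

Let rs_path_right_continuous : right_continuous (rs_path p w).
Proof.
move=> t; rewrite [X in _ --> X]/rs_path; case: ifPn => [t0|].
  apply: (@cvg_trans _ (p s w @[s --> t^'+])); last exact: rs_right_continuous.
  apply: near_eq_cvg; near=> s; rewrite /rs_path ifT//.
  by apply: (le_trans t0); apply: ltW; near: s; exact: nbhs_right_gt.
rewrite -ltNge => t0; apply: (@cvg_trans _ ((fun=> 0 : R) @ t^'+)); last exact: cvg_cst.
apply: near_eq_cvg; near=> s; rewrite /rs_path ifF//; apply/negbTE.
by rewrite -ltNge; near: s; exact: nbhs_right_lt.
Unshelve. all: by end_near.
Qed.

HB.instance Definition _ := isCumulative.Build R _ R (rs_path p w)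
  rs_path_nondecreasing rs_path_right_continuous.

End rs_path_cumulative.

(* inf of the empty set is 0 in the library: this is the value at u = 1. *)
Definition Theta F (p : randomized_stopping F) (u : R) (w : Omega) : R :=
  inf [set t | 0 <= t /\ u < p t w].

End filtration.

Definition others (N : nat) (i : 'I_N) := {j : 'I_N | j != i}.

Section game.
Context (R : realType) (d0 : measure_display) (Omega : measurableType d0).
Variables (P : probability Omega R) (d N : nat).
Variable (X : R -> Omega -> d.-tuple (measurableTypeR R)).
Variable (h : forall i : 'I_N,
  d.-tuple (measurableTypeR R) -> R -> {ffun others i -> bool} -> R).
Implicit Types (i j : 'I_N) (tau : 'I_N -> Omega -> R).

(* The finite factor {0,1}^(N-1) is discrete, so that joint measurability is
   measurability of each section in the two other variables. *)
Definition measurable_payoff i :=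
  forall a : {ffun others i -> bool},
    measurable_fun ([set: d.-tuple (measurableTypeR R)]
                    `*` ([set` `[0, +oo[] : set (measurableTypeR R)))
      ((fun z => h z.1 z.2 a)
        : d.-tuple (measurableTypeR R) * measurableTypeR R ->
          measurableTypeR R).

Definition payoff_at i tau (w : Omega) : R :=
  h (X (tau i w) w) (tau i w) [ffun j : others i => tau (val j) w <= tau i w].

Definition J i tau : \bar R := 'E_P[payoff_at i tau].

Definition payoff_bounded (F : R -> set (set Omega)) i :=
  (ereal_sup [set 'E_P[fun w => `|payoff_at i tau w|%R]
             | tau in [set tau | forall j, stopping_time F (tau j)]] < +oo)%E.

Definition JR (F : R -> set (set Omega)) (p : 'I_N -> randomized_stopping F) i
    : \bar R :=
  (\int[lebesgue_measure_tuple R N]_(u in @unit_cube R N)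
     J i (fun j => Theta (p j) (tnth u j)))%E.

Definition gN i (x : d.-tuple (measurableTypeR R)) (t : R)
    (q : others i -> R) : R :=
  \sum_(a : {ffun others i -> bool})
    h x t a * \prod_(j : others i) (q j ^+ a j * (1 - q j) ^+ (1 - a j)%N).

End game.

(* Main.v *)
Require Import Defs.
From HB Require Import structures.
From mathcomp Require Import all_boot all_order all_algebra.
From mathcomp Require Import all_classical all_reals all_analysis.
From mathcomp Require Import measurable_realfun.

Set Implicit Arguments.
Unset Strict Implicit.
Unset Printing Implicit Defensive.
Import Order.TTheory GRing.Theory Num.Theory.
Import numFieldNormedType.Exports.

Local Open Scope classical_set_scope.
Local Open Scope ring_scope.

(* Write theta_j(u) for Theta (p j) u w. For fixed w, theta_j(u) <= t holds for
   a set of u in [0,1] of measure p^j_t, so theta_j carries Lebesgue measure on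
   [0,1] to dp^j. The function g^N is the multilinear extension of h_i in the
   0/1 variables, so that integrating the payoff over the independent
   coordinates u_j, j <> i, replaces each indicator of
   theta_j(u_j) <= theta_i(u_i) by its mean p^j at time theta_i(u_i); what
   remains is the integral over u_i of g^N at time theta_i(u_i), which is the
   Stieltjes integral against dp^i. Tonelli exchanges the expectation with the
   integral over the cube for the positive and negative parts of h_i; both are
   finite because each Theta (p j) u is a stopping time. *)

(** * Products of measurable functions and iterated integration over tuples *)

Lemma measurable_prod_cond (d : measure_display) (T : measurableType d)
    (R : realType) (I : finType) (Q : pred I) (g : I -> T -> R) :
  (forall j, measurable_fun setT (g j)) ->
  measurable_fun setT (fun x => \prod_(j | Q j) g j x).
Proof.
move=> mg; under eq_fun do rewrite -big_filter.
by apply: measurable_prod => j _.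
Qed.

Section tuple_integral.
Context (R : realType).
Local Notation mR := (measurableTypeR R).
Local Notation leb := (@lebesgue_measure R).
Local Notation lebn := (lebesgue_measure_tuple R).

(** The measure on tuples of length [n.+1] is the image of a product measure under [tcons], so a
    change of variables followed by Tonelli peels off the head coordinate. *)
Lemma ge0_integral_tuple_cons n (f : n.+1.-tuple mR -> \bar R) :
  measurable_fun setT f -> (forall u, 0 <= f u)%E ->
  (\int[lebn n.+1]_u f u = \int[leb]_x \int[lebn n]_u f [tuple of x :: u])%E.
Proof.
move=> mf f0; rewrite [LHS](ge0_integral_pushforward (@measurable_tcons _ mR n))//.
rewrite preimage_setT fubini_tonelli1//.
- by apply: measurableT_comp => //; exact: measurable_tcons.
- by move=> z; exact: f0.
Qed.

Lemma integral_tuple0 (f : 0.-tuple mR -> \bar R) :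
  (\int[lebn 0]_u f u = f [tuple])%E.
Proof.
rewrite (_ : f = cst (f [tuple])); last by apply/funext=> u; rewrite /= (tuple0 u).
by rewrite integral_cst//= diracT mule1.
Qed.

Lemma measurable_prod_tnth n (g : 'I_n -> R -> R) (Q : pred 'I_n) :
  (forall j, measurable_fun setT (g j : mR -> R)) ->
  measurable_fun setT (fun u : n.-tuple mR => \prod_(j | Q j) g j (tnth u j)).
Proof.
move=> mg; apply: (@measurable_prod_cond _ _ R _ _
  (fun j (u : n.-tuple mR) => g j (tnth u j))) => j.
by apply: (measurableT_comp (mg j)); exact: measurable_tnth.
Qed.

(** Independence of the coordinates: by induction on [n], the factor of the head leaves the integral
    over the tail as a constant. *)
Lemma integral_tuple_prod n (g : 'I_n -> R -> R) (q : 'I_n -> R) :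
  (forall j, measurable_fun setT (g j : mR -> R)) -> (forall j x, 0 <= g j x) ->
  (forall j, \int[leb]_x (g j x)%:E = (q j)%:E)%E ->
  (\int[lebn n]_u (\prod_j g j (tnth u j))%:E = (\prod_j q j)%:E)%E.
Proof.
elim: n g q => [|n IH] g q mg g0 gq; first by rewrite integral_tuple0 !big_ord0.
rewrite ge0_integral_tuple_cons; first last.
- by move=> u; rewrite lee_fin prodr_ge0.
- by apply/measurable_EFinP; exact: (@measurable_prod_tnth _ g xpredT).
have E x : (\int[lebn n]_u (\prod_j g j (tnth [tuple of x :: u] j))%:E =
   (g ord0 x)%:E * (\prod_(j < n) q (lift ord0 j))%:E)%E.
  rewrite -(IH (fun j => g (lift ord0 j)))// -ge0_integralZl_EFin//; first last.
  - apply/measurable_EFinP.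
    exact: (@measurable_prod_tnth _ (fun j => g (lift ord0 j)) xpredT).
  - by move=> u _; rewrite lee_fin prodr_ge0.
  apply: eq_integral => u _; rewrite big_ord_recl tnth0 EFinM; congr (_ * (_)%:E)%E.
  by apply: eq_bigr => j _; rewrite tnthS.
under eq_integral do rewrite E.
have q0 j : 0 <= q j by rewrite -lee_fin -gq integral_ge0// => x _; rewrite lee_fin.
rewrite ge0_integralZr//; first last.
- by rewrite lee_fin prodr_ge0.
- by move=> x _; rewrite lee_fin.
- exact/measurable_EFinP.
by rewrite gq -EFinM -big_ord_recl.
Qed.

Lemma measurable_tuple_pivot n (i : 'I_n) (f : R -> \bar R)
    (G : 'I_n -> R -> R -> R) :
  measurable_fun setT (f : mR -> \bar R) ->
  (forall j, measurable_fun setT ((fun z => G j z.1 z.2) : mR * mR -> R)) ->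
  measurable_fun setT (fun u : n.-tuple mR =>
    (f (tnth u i) * (\prod_(j | j != i) G j (tnth u i) (tnth u j))%:E)%E).
Proof.
move=> mf mG; apply: emeasurable_funM.
  by apply: (measurableT_comp mf); exact: measurable_tnth.
apply/measurable_EFinP.
apply: (@measurable_prod_cond _ _ R _ _
  (fun j (u : n.-tuple mR) => G j (tnth u i) (tnth u j))) => j.
apply: (measurableT_comp (mG j) (g := fun u : n.-tuple mR => (tnth u i, tnth u j))).
by apply/measurable_fun_pairP; split; exact: measurable_tnth.
Qed.

(* Conditionally on the pivot coordinate the others are independent, so each
   factor is replaced by its mean given the pivot. *)
Lemma integral_tuple_pivot n (i : 'I_n) (f : R -> \bar R)
    (G : 'I_n -> R -> R -> R) (q : 'I_n -> R -> R) :
  measurable_fun setT (f : mR -> \bar R) -> (forall x, 0 <= f x)%E ->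
  (forall j, measurable_fun setT ((fun z => G j z.1 z.2) : mR * mR -> R)) ->
  (forall j x y, 0 <= G j x y) ->
  (forall j x, \int[leb]_y (G j x y)%:E = (q j x)%:E)%E ->
  (\int[lebn n]_u (f (tnth u i) *
     (\prod_(j | j != i) G j (tnth u i) (tnth u j))%:E) =
   \int[leb]_x (f x * (\prod_(j | j != i) q j x)%:E))%E.
Proof.
elim: n i f G q => [[]//|n IH] i f G q mf f0 mG G0 Gq.
have q0 j x : 0 <= q j x.
  by rewrite -lee_fin -Gq integral_ge0// => y _; rewrite lee_fin.
(* Each [q j] is a partial integral of the jointly measurable [G j], hence measurable by Tonelli. *)
have mq j : measurable_fun setT (q j : mR -> R).
  apply/measurable_EFinP.
  have := measurable_fun_fubini_tonelli_F (m2 := leb) (fun z : mR * mR => (G j z.1 z.2)%:E).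
  rewrite /fubini_F/= (_ : (fun x => _) = EFin \o q j); last first.
    by apply/funext => x; rewrite Gq.
  by apply; [exact/measurable_EFinP|move=> z; rewrite lee_fin].
rewrite ge0_integral_tuple_cons; first last.
- by move=> u; rewrite mule_ge0// lee_fin prodr_ge0.
- exact: measurable_tuple_pivot.
(* If the pivot is the head, freezing it leaves a product of functions of separate tail coordinates.
   If it lies in the tail, the head contributes one more factor depending on the pivot. *)
case: (unliftP ord0 i) => [k ->|->]; last first.
  apply: eq_integral => x _.
  have recl (H : 'I_n.+1 -> R) : \prod_(j | j != ord0) H j = \prod_(j < n) H (lift ord0 j).
    by rewrite big_mkcond big_ord_recl eqxx/= mul1r.
  rewrite recl; under eq_integral do rewrite tnth0 recl.
  have mGx j : measurable_fun setT (G (lift ord0 j) x : mR -> R).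
    exact: (measurableT_comp (mG (lift ord0 j)) (pair1_measurable (x : mR))).
  rewrite ge0_integralZl//; first last.
  - by move=> u _; rewrite lee_fin prodr_ge0.
  - apply/measurable_EFinP.
    under eq_fun do under eq_bigr do rewrite tnthS.
    exact: (@measurable_prod_tnth _ (fun j => G (lift ord0 j) x) xpredT).
  under eq_integral do under eq_bigr do rewrite tnthS.
  by rewrite (@integral_tuple_prod n (fun j => G (lift ord0 j) x) (fun j => q (lift ord0 j) x)).
have recl (H : 'I_n.+1 -> R) :
    \prod_(j | j != lift ord0 k) H j = H ord0 * \prod_(j | j != k) H (lift ord0 j).
  rewrite big_mkcond big_ord_recl/=; congr (_ * _).
  by rewrite [RHS]big_mkcond; apply: eq_bigr => j _; rewrite (inj_eq lift_inj).
(* With the head frozen at [x], its factor depends only on the pivot [y] and is absorbed into [f],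
   so that the induction hypothesis applies to the tail. *)
pose f' x y := (f y * (G ord0 y x)%:E)%E.
have mf' : measurable_fun setT (fun z : mR * mR => f' z.1 z.2).
  apply: emeasurable_funM; first exact: measurableT_comp mf _.
  apply/measurable_EFinP.
  apply: (measurableT_comp (mG ord0) (g := fun z : mR * mR => (z.2, z.1))).
  exact: measurable_fun_pair.
have f'0 x y : (0 <= f' x y)%E by rewrite mule_ge0// lee_fin.
pose Q y := \prod_(j | j != k) q (lift ord0 j) y.
have Q0 y : 0 <= Q y by rewrite prodr_ge0.
have mQ : measurable_fun setT (Q : mR -> R).
  exact: (@measurable_prod_cond _ _ R _ _ (fun j => q (lift ord0 j) : mR -> R)).
have E x : (\int[lebn n]_u (f (tnth [tuple of x :: u] (lift ord0 k)) *
    (\prod_(j | j != lift ord0 k) G j (tnth [tuple of x :: u] (lift ord0 k))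
       (tnth [tuple of x :: u] j))%:E) = \int[leb]_y (f' x y * (Q y)%:E))%E.
  rewrite -(IH k (f' x) (fun j => G (lift ord0 j)) (fun j => q (lift ord0 j)))//.
    apply: eq_integral => u _; rewrite recl tnthS tnth0 EFinM muleA.
    by congr (_ * _%:E)%E; apply: eq_bigr => j _; rewrite tnthS.
  exact: (measurableT_comp mf' (pair1_measurable (x : mR))).
under eq_integral do rewrite E.
(* Exchanging the integrals lets the head be integrated first, at a fixed pivot, which turns its
   factor into [q ord0 y]. *)
rewrite (@fubini_tonelli _ _ _ _ _ leb leb (fun z => f' z.1 z.2 * (Q z.2)%:E)%E); first last.
- by move=> z; rewrite mule_ge0// lee_fin.
- by apply: emeasurable_funM => //; apply/measurable_EFinP; exact: measurableT_comp mQ _.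
apply: eq_integral => y _ /=; rewrite recl.
under eq_integral do rewrite /f' muleAC.
rewrite ge0_integralZl//; first last.
- by rewrite mule_ge0// lee_fin.
- by move=> x _; rewrite lee_fin.
- apply/measurable_EFinP.
  exact: (measurableT_comp (mG ord0) (pair1_measurable (y : mR))).
by rewrite Gq -muleA -EFinM mulrC.
Qed.

(** In product form the restriction to the cube is distributed over the coordinates and can join the
    factors of an integrand of product type. *)
Lemma indic_unit_cube n (u : n.-tuple mR) :
  \1_(@unit_cube R n) u = \prod_j \1_`[0%R, 1%R] (tnth u j) :> R.
Proof.
rewrite indicE; have [|/negP ucube] := boolP (u \in @unit_cube R n).
  rewrite inE => ucube; rewrite big1// => j _.
  by rewrite indicE mem_set//= in_itv/=; exact: ucube.
have [k uk] : exists k, ~ (0 <= tnth u k <= 1).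
  by apply/existsNP => ucube'; apply: ucube; rewrite inE.
by rewrite (bigD1 k)//= indicE memNset ?mul0r//= in_itv/=.
Qed.

Lemma measurable_unit_cube n : measurable (@unit_cube R n).
Proof.
rewrite (_ : @unit_cube R n =
    \bigcap_(k in [set: 'I_n]) ((@tnth n mR ^~ k) @^-1` `[0, 1])); last first.
  apply/seteqP; split=> u ucube k; first by move=> _ /=; rewrite in_itv/=; exact: ucube.
  by have := ucube k I; rewrite /= in_itv/=.
apply: fin_bigcap_measurable => // k _.
by rewrite -[X in measurable X]setTI; exact: (measurable_tnth k).
Qed.

Lemma lebesgue_measure_unit_cube n : lebn n (@unit_cube R n) = 1%E.
Proof.
have mcube := @measurable_unit_cube n.
rewrite -[@unit_cube R n]setIT -integral_indic//.
under eq_integral do rewrite indic_unit_cube.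
rewrite (@integral_tuple_prod _ (fun=> \1_`[0%R, 1%R]) (fun=> 1)) ?big1//.
by move=> _; rewrite integral_indic// setIT [LHS]lebesgue_measure_itv/= lte_fin ltr01 sube0.
Qed.

End tuple_integral.

(** * Measurability of comparison sets and the uniform law on [[0, 1]] *)

Section measurable_comparison.
Context (d : measure_display) (T : measurableType d) (R : realType).
Variables f g : T -> R.
Hypotheses (mf : measurable_fun setT f) (mg : measurable_fun setT g).

Lemma measurable_set_ler : measurable [set x | f x <= g x].
Proof.
have := measurable_fun_ler mf mg measurableT (Y := [set true]).
by rewrite setTI; apply.
Qed.

Lemma measurable_set_ltr : measurable [set x | f x < g x].
Proof.
have := measurable_fun_ltr mf mg measurableT (Y := [set true]).
by rewrite setTI; apply.
Qed.

End measurable_comparison.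

Lemma uniform_prob01E (R : realType) (A : set (measurableTypeR R)) :
  measurable A ->
  uniform_prob (@ltr01 R) A = lebesgue_measure (A `&` `[0, 1]).
Proof.
move=> mA; rewrite -[in LHS](setIT A) -integral_indic// integral_uniform//.
  by rewrite subr0 invr1 mul1e integral_indic.
exact/measurable_EFinP/measurable_indic.
Qed.

(** * The law of the randomized stopping time, path by path *)

Section theta.
Context (R : realType) (d0 : measure_display) (Omega : measurableType d0).
Variables (P : probability Omega R) (F : R -> set (set Omega)).
Hypothesis F_usual : usual_conditions P F.
Variable p : randomized_stopping F.
Local Notation mR := (measurableTypeR R).
Local Notation leb := (@lebesgue_measure R).
Implicit Types (t u : R) (w : Omega).

Lemma Theta_ge0 u w : 0 <= Theta p u w.
Proof.
rewrite /Theta; have [->|/set0P ne] := eqVneq [set t | 0 <= t /\ u < p t w] set0.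
  by rewrite inf0.
by apply: lb_le_inf => // t [].
Qed.

(** As [p] never exceeds 1, the defining set is empty and [inf] takes its default value 0. Within
    [[0, 1]] this concerns only the null set [u = 1]. *)
Lemma Theta_ge1 u w : 1 <= u -> Theta p u w = 0.
Proof.
move=> u1; rewrite /Theta (_ : [set t | _] = set0) ?inf0//.
rewrite -subset0 => t [t0 /lt_le_trans]; have /andP[_ pt1] := rs_range p w t0.
by move=> /(_ _ pt1); rewrite ltNge u1.
Qed.

Lemma Theta_le u w t : 0 <= t -> u < p t w -> Theta p u w <= t.
Proof. by move=> t0 upt; apply: ge_inf => //; exists 0 => s []. Qed.

(** Since [p] tends to 1, the condition [u < 1] makes the defining set nonempty; some time before
    [t] then belongs to it, and [p] is nondecreasing. *)
Lemma Theta_lt u w t : u < 1 -> Theta p u w < t -> u < p t w.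
Proof.
move=> u1 /inf_lt[].
  have /cvgr_gt/(_ _ u1) [M [_ HM]] := rs_limit p w.
  exists (Num.max 0 (M + 1)); split; first by rewrite le_max lexx.
  by apply: HM; rewrite lt_max ltrDl ltr01 orbT.
move=> s [s0 ups] st; apply: (lt_le_trans ups).
exact/rs_nondecreasing/ltW.
Qed.

(** The inequality [u < p t w] can fail when the infimum equals [t], hence the times decreasing to
    [t]. They are countably many, for measurability, and stay within [e] of [t], so that they can be
    kept below any prescribed later time. *)
Lemma Theta_leP u w t e : u < 1 -> 0 <= t -> 0 < e ->
  Theta p u w <= t <-> forall n, u < p (t + e / n.+1%:R) w.
Proof.
move=> u1 t0 e0; split=> [ut n|H].
  by apply: Theta_lt => //; rewrite (le_lt_trans ut)// ltrDl divr_gt0.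
apply/ler_addgt0Pr => d d_gt0.
(* The integer part satisfies [e / d < n.+1], that is [e / n.+1 < d]. *)
pose n := Num.trunc (e / d).
have ed : e / n.+1%:R <= d.
  rewrite ler_pdivrMr// -ler_pdivrMl// mulrC ltW//.
  by have /andP[] := truncn_itv (ltW (divr_gt0 e0 d_gt0)).
apply: (@le_trans _ _ (t + e / n.+1%:R)); last by rewrite lerD2l.
by apply: Theta_le; rewrite ?H// addr_ge0// divr_ge0// ltW.
Qed.

(** By right-continuity of [F] it suffices to place the event in [F s] for every [s > t].
    [Theta_leP] with [e = s - t] describes it through [p] at countably many times, none later than
    [s]. *)
Lemma stopping_time_Theta u : stopping_time F (Theta p u).
Proof.
have [Ff nF rcF] := F_usual.
split=> [w|t t0]; first exact: Theta_ge0.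
have [u1|u1] := leP 1 u.
  rewrite (_ : [set w | _] = setT); last first.
    by apply/seteqP; split=> // w _ /=; rewrite Theta_ge1.
  have [+ FC _] := filtration_sigma Ff t0.
  by move=> /FC; rewrite setD0.
rewrite rcF// => s /=; rewrite in_itv/= andbT => ts.
have s0 : 0 <= s by rewrite (le_trans t0)// ltW.
have e0 : 0 < s - t by rewrite subr_gt0.
rewrite (_ : [set w | _] =
    \bigcap_n ((p (t + (s - t) / n.+1%:R)) @^-1` `]u, +oo[)); last first.
  apply/seteqP; split=> w /=.
    by move=> /(Theta_leP w u1 t0 e0) H n _ /=; rewrite in_itv/= H.
  move=> H; apply/(Theta_leP w u1 t0 e0) => n.
  by have := H n I; rewrite /= in_itv/= andbT.
have [F0 FC FU] := filtration_sigma Ff s0.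
(* The sigma-algebra axioms speak of complements and countable unions, so the intersection is
   rewritten as the complement of a union. *)
rewrite -[X in F s X]setCK -setTD; apply: (FC).
rewrite setC_bigcap; apply: FU => n.
rewrite -setTD; apply: (FC).
have tn : 0 <= t + (s - t) / n.+1%:R by rewrite addr_ge0// divr_ge0// ltW.
apply: (filtration_nd Ff tn); last by apply: rs_adapted => //; exact: measurable_itv.
by rewrite -lerBrDl ler_pdivrMr// ler_peMr ?ler1n// ltW.
Qed.

Lemma measurable_rs t : 0 <= t -> measurable_fun setT (p t).
Proof.
move=> t0 _ B mB; rewrite setTI.
apply: (filtration_sub (usual_filtration F_usual) t0).
exact: rs_adapted.
Qed.

(** [Theta_leP] with [e = 1] describes the set where [Theta] is at most [t] by countably many
    conditions on [p] at fixed times, each jointly measurable in [w] and [u]; the levels [u >= 1]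
    are added separately. *)
Lemma measurable_Theta :
  measurable_fun setT (fun z : Omega * mR => Theta p z.2 z.1).
Proof.
apply: (measurability (@RGenOInfty.G R)); first exact: RGenOInfty.measurableE.
move=> _ [_ [t ->] <-]; rewrite setTI.
have [t0|t0] := ltP t 0.
  rewrite (_ : _ @^-1` _ = setT)//; apply/seteqP; split=> // z _ /=.
  by rewrite in_itv/= andbT (lt_le_trans t0)// Theta_ge0.
rewrite (_ : _ @^-1` _ = ~` ([set z : Omega * mR | 1 <= z.2] `|`
  \bigcap_n [set z : Omega * mR | z.2 < p (t + 1 / n.+1%:R) z.1])); last first.
  apply/seteqP; split=> [z /= + H|z /= H].
    rewrite in_itv/= andbT ltNge => /negP; apply.
    have [z1|z1] := leP 1 z.2; first by rewrite Theta_ge1.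
    case: H => [|H]; first by move=> /le_lt_trans/(_ z1); rewrite ltxx.
    by apply/(@Theta_leP _ _ _ 1) => // n; exact: H.
  rewrite in_itv/= andbT ltNge; apply/negP => zt; apply: H.
  have [z1|z1] := leP 1 z.2; [by left|right => n _ /=].
  by move: n; apply/(@Theta_leP _ _ _ 1).
apply: measurableC; apply: measurableU.
  exact: (measurable_set_ler (f := cst 1) (g := snd : Omega * mR -> R)).
apply: bigcapT_measurable => n.
apply: (measurable_set_ltr (f := snd : Omega * mR -> R)
  (g := p (t + 1 / n.+1%:R) \o fst)) => //.
by apply: measurableT_comp => //; apply: measurable_rs; rewrite addr_ge0// divr_ge0.
Qed.

Lemma measurable_Theta_path w : measurable_fun setT (Theta p ^~ w : mR -> mR).
Proof. exact: (measurableT_comp measurable_Theta (pair1_measurable w)). Qed.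

(** For [t >= 0] the set lies between [[0, p t w[] and [[0, p t w]] enlarged by the point 1, where
    [Theta] has its default value. Both bounds have length [p t w]. *)
Lemma lebesgue_measure_Theta_le w t :
  leb ([set u | Theta p u w <= t] `&` `[0, 1]) = (rs_path p w t)%:E.
Proof.
have [t0|t0] := ltP t 0.
  rewrite (_ : _ `&` _ = set0) ?measure0 /rs_path; last first.
    rewrite -subset0 => u [/= /le_lt_trans/(_ t0)].
    by rewrite ltNge Theta_ge0.
  by rewrite leNgt t0.
rewrite /rs_path t0; have /andP[p0 p1] := rs_range p w t0.
set A := _ `&` _.
have mA : measurable A.
  by apply: measurableI => //; exact: (measurable_set_ler (measurable_Theta_path w) (g := cst t)).
have lebp b : leb [set` Interval (BLeft 0) (BSide b (p t w))] = (p t w)%:E.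
  rewrite lebesgue_measure_itv/= lte_fin sube0.
  by case: ltP => // p00; congr EFin; apply/eqP; rewrite eq_le p0.
apply/eqP; rewrite eq_le; apply/andP; split.
  apply: (@le_trans _ _ (leb (`[0, p t w] `|` [set 1]))).
    apply: le_measure; rewrite ?inE//; first exact: measurableU.
    move=> u [/= ut]; rewrite in_itv/= => /andP[u0 u1].
    move: u1; rewrite le_eqVlt => /predU1P[->|u1]; [by right|left].
    (* If [p t w < u], right-continuity gives [p s w < u] at some [s > t], whereas [Theta p u w < s]
       forces [u < p s w]. *)
    rewrite in_itv/= u0 leNgt; apply/negP => ptu.
    have /cvgr_lt/(_ _ ptu) near_lt := @rs_right_continuous _ _ _ _ p w t t0.
    near (t^'+) => s.
    have : p s w < u by near: s.
    apply/negP; rewrite -leNgt ltW//; apply: Theta_lt => //.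
    by rewrite (le_lt_trans ut).
  apply: (le_trans (measureU2 _ _ _)) => //.
  by rewrite [X in (X + _)%E](lebp false) [X in (_ + X)%E]lebesgue_measure_set1 adde0.
rewrite -(lebp true); apply: le_measure; rewrite ?inE// => u.
rewrite /= in_itv/= => /andP[u0 up]; split; first exact: Theta_le.
by rewrite /= in_itv/= u0 (le_trans (ltW up)).
Unshelve. all: by end_near.
Qed.

(* Inverse transform sampling. *)
Lemma lebesgue_stieltjes_measure_Theta w (A : set mR) : measurable A ->
  lebesgue_stieltjes_measure (rs_path p w) A =
  pushforward (uniform_prob (@ltr01 R)) (Theta p ^~ w) A.
Proof.
have mTh := measurable_Theta_path w.
apply: (lebesgue_stieltjes_measure_unique (mu := pushforward
  (uniform_prob (@ltr01 R)) (Theta p ^~ w : mR -> mR))) => _ [[a b] _ <-]/=.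
have [ba|ab] := ltP b a.
  by rewrite set_itv_ge ?measure0// bnd_simp -leNgt ltW.
have mle c : measurable ([set u : mR | Theta p u w <= c] `&` `[0, 1]).
  by apply: measurableI => //; exact: (measurable_set_ler mTh (g := cst c)).
rewrite /lebesgue_stieltjes_measure /measure_extension measurable_mu_extE/=; last first.
  exact: is_ocitv.
rewrite wlength_itv_bnd// /pushforward uniform_prob01E; last first.
  by rewrite -[X in measurable X]setTI; exact: mTh.
(* The preimage of []a, b]] is a difference of nested sublevel sets, whose measures are the values
   of [rs_path] at [b] and [a], also at negative endpoints. *)
rewrite (_ : _ `&` _ = ([set u : mR | Theta p u w <= b] `&` `[0, 1]) `\`
                       ([set u : mR | Theta p u w <= a] `&` `[0, 1])); last first.
  apply/seteqP; split=> u /=; rewrite !in_itv/=.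
    by move=> [/andP[au ub] u01]; split=> // -[ua]; rewrite ltNge ua in au.
  move=> [[ub u01] H]; split=> //; rewrite ub andbT ltNge.
  by apply/negP => ua; apply: H.
rewrite measureD//; last by rewrite [X in (X < _)%E]lebesgue_measure_Theta_le ltry.
rewrite [_ `&` _ `&` (_ `&` _)]setIidr; last first.
  by move=> u [/= ua u01]; split=> //=; exact: le_trans ua ab.
by rewrite EFinB -!lebesgue_measure_Theta_le.
Qed.

Lemma integral_Theta w (f : R -> \bar R) :
  measurable_fun ([set` `[0, +oo[] : set mR) f ->
  (\int[lebesgue_stieltjes_measure (rs_path p w)]_(t in `[0%R, +oo[) f t =
   \int[leb]_(u in `[0%R, 1%R]) f (Theta p u w))%E.
Proof.
have ge0 (g : R -> \bar R) : measurable_fun ([set` `[0, +oo[] : set mR) g ->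
    (forall t, 0 <= g t)%E ->
    (\int[lebesgue_stieltjes_measure (rs_path p w)]_(t in `[0%R, +oo[) g t =
     \int[leb]_(u in `[0%R, 1%R]) g (Theta p u w))%E.
  move=> mg g0; have mTh := measurable_Theta_path w.
  rewrite (eq_measure_integral (pushforward (uniform_prob (@ltr01 R))
    (Theta p ^~ w : mR -> mR))); last first.
    by move=> A mA _; exact: lebesgue_stieltjes_measure_Theta.
  have Tpre : (Theta p ^~ w : mR -> mR) @^-1` `[0, +oo[ = setT.
    by apply/seteqP; split=> // u _ /=; rewrite in_itv/= Theta_ge0.
  rewrite ge0_integral_pushforward// Tpre integral_uniform//; first last.
  - by move=> u; exact: g0.
  - apply: (measurable_comp (F := [set` `[0, +oo[] : set mR)) => //.
    by move=> _ [u _ <-]; rewrite /= in_itv/= Theta_ge0.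
  by rewrite subr0 invr1 mul1e.
(* For a function of arbitrary sign, the change of variables is applied to the positive and negative
   parts, which commute with composition by [Theta]. *)
move=> mf; rewrite integralE [RHS]integralE.
congr (_ - _)%E.
  rewrite ge0//; last exact: measurable_funepos.
  by apply: eq_integral => u _; rewrite !funeposE.
rewrite ge0//; last exact: measurable_funeneg.
by apply: eq_integral => u _; rewrite !funenegE.
Qed.

End theta.

(** * Sampling a right-continuous process at a random time *)

Section random_time.
Context (R : realType) (d : measure_display) (T : measurableType d).

(** Moving up to the next point of the grid of mesh [1 / n.+1] overshoots [t] strictly, by at most
    the mesh; strictness is what convergence to [t^'+] demands. *)
Let ceil_cvg (t : R) : 0 <= t ->
  ((Num.trunc (n.+1%:R * t)).+1%:R / n.+1%:R : R) @[n --> \oo] --> t^'+.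
Proof.
move=> t0 A /nbhs_ballP[e /= e0 teA].
have n0 n : 0 < n.+1%:R :> R by rewrite ltr0Sn.
rewrite -[nbhs _ _]/(\forall n \near \oo, A ((Num.trunc (n.+1%:R * t)).+1%:R / n.+1%:R)).
near=> n; have /andP[k1 k2] := truncn_itv (mulr_ge0 (ltW (n0 n)) t0).
apply: teA => /=; last by rewrite ltr_pdivlMr// mulrC.
rewrite /ball/= ltr_distlC; apply/andP; split.
  by rewrite ltr_pdivlMr// (le_lt_trans _ k2)// mulrC ler_pM2l// gerBl ltW.
rewrite -natr1 mulrDl mul1r ler_ltD//.
  by rewrite ler_pdivrMr// [leRHS]mulrC.
by near: n; exact: (near_infty_natSinv_lt (PosNum e0)).
Unshelve. all: by end_near.
Qed.

(** With [tau] rounded up to a grid, the sampled value is glued from countably many fixed-time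
    variables over measurable pieces; right-continuity passes to the limit as the mesh shrinks. *)
Lemma measurable_right_continuous_at (Y : R -> T -> R) (tau : T -> R) :
  (forall t, 0 <= t -> measurable_fun setT (Y t)) ->
  (forall x t, 0 <= t -> Y s x @[s --> t^'+] --> Y t x) ->
  measurable_fun setT tau -> (forall x, 0 <= tau x) ->
  measurable_fun setT (fun x => Y (tau x) x).
Proof.
move=> mY rcY mtau tau0.
pose k n x := Num.trunc (n.+1%:R * tau x).
apply: (measurable_fun_cvg (h := fun n x => Y ((k n x).+1%:R / n.+1%:R) x)); last first.
  by move=> x _; exact: (cvg_comp _ (Y ^~ x) (ceil_cvg (tau0 x)) (rcY x _ (tau0 x))).
move=> n _ B mB; rewrite setTI.
rewrite (_ : _ @^-1` B =
    \bigcup_j ([set x | k n x = j] `&` Y (j.+1%:R / n.+1%:R) @^-1` B)); last first.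
  apply/seteqP; split=> [x /= ?|x [j _ [/= <-]]//].
  by exists (k n x).
apply: bigcupT_measurable => j; apply: measurableI; last first.
  by rewrite -[X in measurable X]setTI; apply: mY => //; rewrite divr_ge0.
rewrite (_ : [set x | _] = [set x | j%:R <= n.+1%:R * tau x] `&`
                           [set x | n.+1%:R * tau x < j.+1%:R]); last first.
  apply/seteqP; split=> x /=.
    by move=> <-; apply/andP; apply: truncn_itv; rewrite mulr_ge0.
  by move=> /andP/truncn_def.
have mtn : measurable_fun setT (fun x => n.+1%:R * tau x).
  exact: measurable_funM.
apply: measurableI.
  exact: (measurable_set_ler (f := cst j%:R)).
exact: (measurable_set_ltr (g := cst j.+1%:R)).
Qed.

End random_time.

(** * Bernoulli weights and the multilinear extension of the payoff *)

Definition bernoulli_weight (R : realType) (c : bool) (q : R) : R :=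
  q ^+ c * (1 - q) ^+ (1 - c)%N.

(** At the vertices the convention [0 ^+ 0 = 1] turns the weight into a Kronecker delta. *)
Lemma bernoulli_weight_bool (R : realType) (c b : bool) :
  bernoulli_weight c (b%:R : R) = (b == c)%:R.
Proof.
by rewrite /bernoulli_weight; case: b c => -[];
  rewrite /= ?subrr ?subr0 ?expr0 ?expr1 ?mulr1 ?mul0r ?mulr0.
Qed.

Lemma bernoulli_weight_ge0 (R : realType) (c : bool) (q : R) :
  0 <= q <= 1 -> 0 <= bernoulli_weight c q.
Proof. by move=> /andP[q0 q1]; rewrite mulr_ge0// exprn_ge0// subr_ge0. Qed.

Lemma measurable_bernoulli_weight (d : measure_display) (T : measurableType d)
    (R : realType) (c : bool) (q : T -> R) :
  measurable_fun setT q ->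
  measurable_fun setT (fun x => bernoulli_weight c (q x)).
Proof.
move=> mq; apply: measurable_funM; apply: measurable_funX => //.
exact: measurable_funB.
Qed.

Lemma measurable_natr_ler (d : measure_display) (T : measurableType d)
    (R : realType) (f g : T -> R) :
  measurable_fun setT f -> measurable_fun setT g ->
  measurable_fun setT (fun x => (f x <= g x)%R%:R : R).
Proof.
move=> mf mg.
rewrite (_ : (fun x => _) = fun x => if f x <= g x then 1 else 0); last first.
  by apply/funext => x; case: (_ <= _).
by apply: measurable_fun_ifT => //; exact: measurable_fun_ler.
Qed.

Lemma big_others (S : Type) (idx : S) (op : Monoid.com_law idx) (N : nat)
    (i : 'I_N) (f : 'I_N -> S) :
  \big[op/idx]_(j : others i) f (val j) = \big[op/idx]_(j | j != i) f j.
Proof.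
rewrite [RHS](reindex_omap (val : others i -> 'I_N) insub); last first.
  by move=> j ji; rewrite insubT.
by apply: eq_bigl => j; rewrite valK eqxx andbT; exact/esym/(valP j).
Qed.

Lemma restrict_EFin_indic (T : Type) (R : realType) (D : set T) (f : T -> R) x :
  ((fun x => (f x)%:E) \_ D) x = (\1_D x * f x)%:E.
Proof. by rewrite patchE indicE; case: ifP => _; rewrite ?mul1r ?mul0r. Qed.

Section multilinear_extension.
Context (R : realType) (d N : nat).
Local Notation mR := (measurableTypeR R).
Implicit Types (i : 'I_N) (x : d.-tuple mR) (t : R).
Implicit Type h : forall i : 'I_N, d.-tuple mR -> R -> {ffun others i -> bool} -> R.

(* [gN] extends the payoff multilinearly from the vertices of the cube. *)
Lemma gN_vertex h i x t (b : {ffun others i -> bool}) :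
  gN h x t (fun j => (b j)%:R) = h i x t b.
Proof.
rewrite /gN (bigD1 b)//= [X in _ + X]big1 ?addr0 => [|a ab].
  by rewrite big1 ?mulr1// => j _; rewrite -/(bernoulli_weight _ _) bernoulli_weight_bool eqxx.
have [j baj] : exists j, b j != a j.
  apply/existsP; rewrite -negb_forall; apply: contra ab => /forallP ba.
  by apply/eqP/ffunP => j; apply/esym/eqP.
rewrite (bigD1 j)//= -/(bernoulli_weight _ _) bernoulli_weight_bool (negbTE baj).
by rewrite mul0r mulr0.
Qed.

(** Indexing by ordinals distinct from [i] matches the shape of [integral_tuple_pivot]. The value
    [true] is a filler at [i], an index that the product skips. *)
Lemma gN_prod_ord h i x t (q : 'I_N -> R) :
  gN h x t (fun j : others i => q (val j)) =
  \sum_a h i x t a *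
    \prod_(j | j != i) bernoulli_weight (if insub j is Some k then a k else true) (q j).
Proof.
apply: eq_bigr => a _; congr (_ * _).
by rewrite -big_others; apply: eq_bigr => j _; rewrite valK.
Qed.

Lemma payoff_atE (d0 : measure_display) (Omega : measurableType d0)
    (X : R -> Omega -> d.-tuple mR) h i
    (tau : 'I_N -> Omega -> R) w :
  payoff_at X h i tau w =
  gN h (X (tau i w) w) (tau i w) (fun j : others i => (tau (val j) w <= tau i w)%R%:R).
Proof.
rewrite /payoff_at -gN_vertex; congr gN.
by apply/funext => j; rewrite ffunE.
Qed.

Lemma gN_ge0 h i x t (q : others i -> R) :
  (forall a, 0 <= h i x t a) -> (forall j, 0 <= q j <= 1) -> 0 <= gN h x t q.
Proof.
move=> h0 q01; apply: sumr_ge0 => a _; rewrite mulr_ge0// prodr_ge0// => j _.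
exact: bernoulli_weight_ge0.
Qed.

End multilinear_extension.

(** * Randomized payoffs: measurability, pathwise integration and Tonelli *)

Section representation.
Context (R : realType) (d0 : measure_display) (Omega : measurableType d0).
Variables (P : probability Omega R) (d N : nat) (F : R -> set (set Omega)).
Variable X : R -> Omega -> d.-tuple (measurableTypeR R).
Hypothesis F_usual : usual_conditions P F.
Hypothesis X_measurable :
  forall t, 0 <= t -> measurable_fun [set: Omega] (X t).
Hypothesis X_continuous : forall w (k : 'I_d),
  {within [set` `[0, +oo[], continuous (fun t : R => tnth (X t w) k : R)}.
Variables (p : 'I_N -> randomized_stopping F) (i : 'I_N).
Local Notation mR := (measurableTypeR R).
Local Notation leb := (@lebesgue_measure R).
Local Notation lebn := (lebesgue_measure_tuple R).
Implicit Type h : forall i : 'I_N, d.-tuple mR -> R -> {ffun others i -> bool} -> R.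

Section measurability.
Context (d1 : measure_display) (T : measurableType d1).
Variables (v : T -> Omega) (tau : T -> R).
Hypotheses (mv : measurable_fun setT v) (mtau : measurable_fun setT tau).
Hypothesis tau_ge0 : forall x, 0 <= tau x.

(** The map [v] selects the sample point: [fst] yields joint measurability, [cst w] measurability
    along one path. *)
Lemma measurable_process_at : measurable_fun setT (fun x => X (tau x) (v x)).
Proof.
apply/measurable_fun_tnthP => k.
apply: (measurable_right_continuous_at (Y := fun t x => tnth (X t (v x)) k)) => //.
- move=> t t0; apply: (measurableT_comp (measurable_tnth k)).
  exact: (measurableT_comp (X_measurable t0)).
(* Continuity within [[0, +oo[] is one-sided at 0 and two-sided at positive times; both give the
   right limit. *)
- move=> x t t0; have /continuous_within_itvcyP[ct c0] := @X_continuous (v x) k.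
  move: t0; rewrite le_eqVlt => /predU1P[<-//|t0].
  by apply: cvg_within_filter; apply: ct; rewrite in_itv/= t0.
Qed.

Lemma measurable_rs_at (q : randomized_stopping F) :
  measurable_fun setT (fun x => q (tau x) (v x)).
Proof.
apply: (measurable_right_continuous_at (Y := fun t x => q t (v x))) => //.
- by move=> t t0; apply: (measurableT_comp _ mv); exact: (measurable_rs F_usual).
- by move=> x t t0; exact: rs_right_continuous.
Qed.

Lemma measurable_payoff_process h a : measurable_payoff h i ->
  measurable_fun setT (fun x => h i (X (tau x) (v x)) (tau x) a).
Proof.
move=> mh; apply: (measurable_comp (F := [set: d.-tuple mR] `*` ([set` `[0, +oo[] : set mR))
  _ _ (mh a) (g := fun x => (X (tau x) (v x), tau x : mR))).
- exact: measurableX.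
- by move=> _ [x _ <-]; split=> //=; rewrite in_itv/= tau_ge0.
- by apply: measurable_fun_pair => //; exact: measurable_process_at.
Qed.

Lemma measurable_gN h (q : others i -> T -> R) : measurable_payoff h i ->
  (forall j, measurable_fun setT (q j)) ->
  measurable_fun setT (fun x => gN h (X (tau x) (v x)) (tau x) (q ^~ x)).
Proof.
move=> mh mq; apply: measurable_sum => a; apply: measurable_funM.
  exact: measurable_payoff_process.
apply: (@measurable_prod_cond _ _ R _ xpredT
  (fun j x => bernoulli_weight (a j) (q j x))) => j.
exact: measurable_bernoulli_weight.
Qed.

End measurability.

Let th (w : Omega) (u : R) := Theta (p i) u w.

Let mth (d1 : measure_display) (T : measurableType d1) (v : T -> Omega)
    (u : T -> mR) (j : 'I_N) : measurable_fun setT v -> measurable_fun setT u ->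
  measurable_fun setT (fun x => Theta (p j) (u x) (v x) : R).
Proof.
move=> mv mu.
apply: (measurableT_comp (measurable_Theta F_usual (p j)) (g := fun x => (v x, u x))).
exact: measurable_fun_pair.
Qed.

(** The integrand is the indicator of the event that [Theta] is at most [t], or of its complement in
    [[0, 1]], with measure [q t w] or [1 - q t w]: the mean of the weight is the weight of the
    mean. *)
Lemma integral_bernoulli_weight_Theta (q : randomized_stopping F) w t c : 0 <= t ->
  (\int[leb]_u (\1_`[0%R, 1%R] u *
     bernoulli_weight c (Theta q u w <= t)%R%:R)%:E =
   (bernoulli_weight c (q t w))%:E)%E.
Proof.
move=> t0; have mle : measurable [set u : mR | Theta q u w <= t].
  exact: (measurable_set_ler (measurable_Theta_path F_usual q w) (g := cst t)).
have E : leb ([set u | Theta q u w <= t] `&` `[0, 1]) = (q t w)%:E.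
  by rewrite (lebesgue_measure_Theta_le F_usual) /rs_path t0.
rewrite (eq_integral (fun u =>
    (\1_([set u : mR | (Theta q u w <= t) == c] `&` `[0, 1]) u)%:E)); last first.
  move=> u _; rewrite bernoulli_weight_bool !indicE in_setI -natrM mulnb andbC.
  congr (_ && _)%:R%:E; apply/idP/idP; first by move=> ?; rewrite inE.
  by rewrite inE.
have mc : measurable [set u : mR | (Theta q u w <= t) == c].
  case: c.
    rewrite (_ : [set u | _] = [set u | Theta q u w <= t])//.
    by apply/seteqP; split=> u /= /eqP.
  rewrite (_ : [set u | _] = ~` [set u : mR | Theta q u w <= t]); first exact: measurableC.
  by apply/seteqP; split=> u /=; [move/eqP/negbT/negP|move/negP/negbTE/eqP].
rewrite integral_indic//; last exact: measurableI.
rewrite setIT.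
case: c mc => mc.
  rewrite /bernoulli_weight expr1 expr0 mulr1 -E; congr (leb (_ `&` _)).
  by apply/seteqP; split=> u /= /eqP.
rewrite /bernoulli_weight expr1 expr0 mul1r.
rewrite (_ : _ `&` _ = `[0, 1] `\` ([set u : mR | Theta q u w <= t] `&` `[0, 1])); last first.
  apply/seteqP; split=> u /=; first by move=> [/eqP nt u01]; split=> // -[]; rewrite nt.
  by move=> [u01 nt]; split=> //; apply/eqP/negbTE/negP => ut; exact: nt.
rewrite measureD//; last 2 first.
- exact: measurableI.
- by rewrite [X in (X < _)%E]lebesgue_measure_itv/= lte_fin ltr01 sube0 ltry.
rewrite setIidr// [X in (_ - X)%E]E.
by rewrite [X in (X - _)%E]lebesgue_measure_itv/= lte_fin ltr01 sube0 EFinB.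
Qed.

Lemma integral_unit_cube_gN h w : measurable_payoff h i ->
  (forall x t a, 0 <= h i x t a) ->
  (\int[lebn N]_(u in @unit_cube R N)
     (payoff_at X h i (fun j => Theta (p j) (tnth u j)) w)%:E =
   \int[leb]_(u in `[0%R, 1%R])
     (gN h (X (th w u) w) (th w u) (fun j : others i => p (val j) (th w u) w))%:E)%E.
Proof.
move=> mh h0.
have mthw : measurable_fun setT (th w : mR -> R) by exact: mth.
have th0 u : 0 <= th w u by exact: Theta_ge0.
(* The pivot function [f] carries the unit-interval indicator of coordinate [i], and each [G a j]
   that of coordinate [j]; together they restore the indicator of the cube. *)
pose f a (u : R) := (\1_`[0%R, 1%R] u * h i (X (th w u) w) (th w u) a)%:E.
pose ext (a : {ffun others i -> bool}) (j : 'I_N) : bool :=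
  if insub j is Some k then a k else true.
pose G a j (u s : R) : R := \1_`[0%R, 1%R] s *
  bernoulli_weight (ext a j) (Theta (p j) s w <= th w u)%R%:R.
pose q a j (u : R) := bernoulli_weight (ext a j) (p j (th w u) w).
have mf a : measurable_fun setT (f a : mR -> \bar R).
  apply/measurable_EFinP; apply: measurable_funM; first exact: measurable_indic.
  exact: (measurable_payoff_process (v := cst w)).
have f0 a u : (0 <= f a u)%E by rewrite lee_fin mulr_ge0// indicE.
have mG a j : measurable_fun setT (fun z : mR * mR => G a j z.1 z.2).
  apply: measurable_funM.
    by apply: measurableT_comp => //; exact: measurable_indic.
  apply: measurable_bernoulli_weight; apply: measurable_natr_ler.
    exact: (mth (v := cst w)).
  exact: (measurableT_comp mthw).
have G0 a j u s : 0 <= G a j u s.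
  by rewrite mulr_ge0// ?indicE// bernoulli_weight_bool.
have mq a j : measurable_fun setT (q a j : mR -> R).
  by apply: measurable_bernoulli_weight; exact: (measurable_rs_at (v := cst w)).
have q0 a j u : 0 <= q a j u by apply/bernoulli_weight_ge0/rs_range.
transitivity (\int[lebn N]_u \sum_a (f a (tnth u i) *
    (\prod_(j | j != i) G a j (tnth u i) (tnth u j))%:E))%E.
  rewrite integral_mkcond; apply: eq_integral => u _.
  rewrite restrict_EFin_indic indic_unit_cube payoff_atE.
  rewrite (gN_prod_ord h _ _ _ (fun j => (Theta (p j) (tnth u j) w <= th w (tnth u i))%R%:R)).
  rewrite mulr_sumr -sumEFin; apply: eq_bigr => a _.
  rewrite /f -EFinM (bigD1 i)//= /G; congr EFin.
  by rewrite [X in _ = _ * X]big_split/= mulrACA.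
transitivity (\int[leb]_u \sum_a (f a u * (\prod_(j | j != i) q a j u)%:E))%E.
  rewrite ge0_integral_sum//; last 2 first.
  - by move=> a; exact: measurable_tuple_pivot.
  - by move=> a u _; rewrite mule_ge0// lee_fin prodr_ge0.
  rewrite ge0_integral_sum//; last 2 first.
  - move=> a; apply: emeasurable_funM => //; apply/measurable_EFinP.
    exact: (@measurable_prod_cond _ _ R _ _ (fun j => q a j : mR -> R)).
  - by move=> a u _; rewrite mule_ge0// lee_fin prodr_ge0.
  apply: eq_bigr => a _; apply: integral_tuple_pivot => // j u.
  exact: integral_bernoulli_weight_Theta.
rewrite [RHS]integral_mkcond; apply: eq_integral => u _.
rewrite restrict_EFin_indic.
rewrite (gN_prod_ord h _ _ _ (fun j => p j (th w u) w)) mulr_sumr -sumEFin.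
by apply: eq_bigr => a _; rewrite /f -EFinM mulrA.
Qed.

(** The discrete argument of [h] varies with the point; writing the payoff as [gN] at a vertex makes
    it a finite sum of products of measurable functions. *)
Lemma measurable_payoff_at_Theta h : measurable_payoff h i ->
  measurable_fun setT (fun z : Omega * N.-tuple mR =>
    payoff_at X h i (fun j => Theta (p j) (tnth z.2 j)) z.1).
Proof.
move=> mh.
pose le_ind (j : others i) (z : Omega * N.-tuple mR) : R :=
  (Theta (p (val j)) (tnth z.2 (val j)) z.1 <= Theta (p i) (tnth z.2 i) z.1)%R%:R.
rewrite [X in measurable_fun _ X](_ : _ = fun z : Omega * N.-tuple mR =>
    gN h (X (Theta (p i) (tnth z.2 i) z.1) z.1) (Theta (p i) (tnth z.2 i) z.1)
      (le_ind ^~ z)); last by apply/funext => z; rewrite payoff_atE.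
have mthj j : measurable_fun setT
    (fun z : Omega * N.-tuple mR => Theta (p j) (tnth z.2 j) z.1 : R).
  by apply: mth => //; apply: (measurableT_comp (measurable_tnth j)).
apply: (measurable_gN (v := fst) (tau := fun z => Theta (p i) (tnth z.2 i) z.1)) => //.
- exact: mthj.
- by move=> z; exact: Theta_ge0.
- by move=> j; exact: (measurable_natr_ler (mthj (val j)) (mthj i)).
Qed.

Lemma integral_randomized_payoff h : measurable_payoff h i ->
  (forall x t a, 0 <= h i x t a) ->
  (\int[lebn N]_(u in @unit_cube R N) \int[P]_w
     (payoff_at X h i (fun j => Theta (p j) (tnth u j)) w)%:E =
   \int[P]_w \int[leb]_(u in `[0%R, 1%R])
     (gN h (X (th w u) w) (th w u) (fun j : others i => p (val j) (th w u) w))%:E)%E.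
Proof.
move=> mh h0.
pose K (z : Omega * N.-tuple mR) :=
  payoff_at X h i (fun j => Theta (p j) (tnth z.2 j)) z.1.
have mK : measurable_fun setT K by exact: measurable_payoff_at_Theta.
have K0 z : 0 <= K z by exact: h0.
have mcube := @measurable_unit_cube R N.
transitivity (\int[P]_w \int[lebn N]_(u in @unit_cube R N) (K (w, u))%:E)%E; last first.
  by apply: eq_integral => w _; exact: integral_unit_cube_gN.
(* The restriction to the cube becomes an indicator factor, so that Tonelli applies on the whole
   product space. *)
under [RHS]eq_integral do rewrite integral_mkcond.
rewrite (eq_integral (fun w => \int[lebn N]_u (\1_(@unit_cube R N) u * K (w, u))%:E)%E);
  last by move=> w _; apply: eq_integral => u _; rewrite restrict_EFin_indic.
rewrite (@fubini_tonelli _ _ _ _ _ P (lebn N)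
  (fun z => (\1_(@unit_cube R N) z.2 * K z)%:E)); first last.
- by move=> z; rewrite lee_fin mulr_ge0// indicE.
- apply/measurable_EFinP; apply: measurable_funM => //.
  by apply: measurableT_comp => //; exact: measurable_indic.
rewrite integral_mkcond; apply: eq_integral => u _; rewrite patchE.
case: ifPn => [|/negbTE] ucube.
  by apply: eq_integral => w _; rewrite indicE ucube mul1r.
by rewrite integral0_eq// => w _; rewrite indicE ucube mul0r.
Qed.

Let gN_Theta h (z : Omega * mR) : R :=
  gN h (X (th z.1 z.2) z.1) (th z.1 z.2) (fun j : others i => p (val j) (th z.1 z.2) z.1).

Lemma measurable_gN_Theta h : measurable_payoff h i ->
  measurable_fun setT (gN_Theta h).
Proof.
move=> mh; have mtau : measurable_fun setT (fun z : Omega * mR => th z.1 z.2 : R).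
  exact: mth.
have tau0 (z : Omega * mR) : 0 <= th z.1 z.2 by exact: Theta_ge0.
apply: (measurable_gN (v := fst) (tau := fun z : Omega * mR => th z.1 z.2)) => // j.
exact: (measurable_rs_at (v := fst)).
Qed.

Lemma measurable_expected_payoff h : measurable_payoff h i ->
  (forall x t a, 0 <= h i x t a) ->
  measurable_fun setT (fun u : N.-tuple mR =>
    (\int[P]_w (payoff_at X h i (fun j => Theta (p j) (tnth u j)) w)%:E)%E).
Proof.
move=> mh h0.
apply: (measurable_fun_fubini_tonelli_G (m1 := P) (fun z : Omega * N.-tuple mR =>
  (payoff_at X h i (fun j => Theta (p j) (tnth z.2 j)) z.1)%:E)).
- by apply/measurable_EFinP; exact: measurable_payoff_at_Theta.
- by move=> z; rewrite lee_fin; exact: h0.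
Qed.

(** At each [u] the times [Theta (p j) (tnth u j)] form a profile of stopping times, so the supremum
    in [payoff_bounded] dominates the expected payoff; the cube has mass one. The function [h']
    stands for the positive or the negative part of [h]. *)
Lemma integral_expected_payoff_lty h h' :
  measurable_payoff h i -> payoff_bounded P X h F i ->
  measurable_payoff h' i -> (forall x t a, 0 <= h' i x t a <= `|h i x t a|) ->
  (\int[lebn N]_(u in @unit_cube R N) \int[P]_w
     (payoff_at X h' i (fun j => Theta (p j) (tnth u j)) w)%:E < +oo)%E.
Proof.
move=> mh hb mh' h'h; have mcube := @measurable_unit_cube R N.
have h'0 x t a : 0 <= h' i x t a by have /andP[] := h'h x t a.
have h'le x t a : h' i x t a <= `|h i x t a| by have /andP[] := h'h x t a.
pose C := ereal_sup [set 'E_P[fun w => `|payoff_at X h i tau w|%R]%E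
             | tau in [set tau | forall j, stopping_time F (tau j)]].
have CE u : (\int[P]_w (payoff_at X h' i (fun j => Theta (p j) (tnth u j)) w)%:E <= C)%E.
  apply: (@le_trans _ _ 'E_P[fun w =>
      `|payoff_at X h i (fun j => Theta (p j) (tnth u j)) w|%R]%E).
    rewrite unlock; apply: ge0_le_integral => //.
    - by move=> w _; rewrite lee_fin; exact: h'0.
    - apply/measurable_EFinP.
      exact: (measurableT_comp (measurable_payoff_at_Theta mh') (pair2_measurable u)).
    - apply/measurable_EFinP; apply: measurableT_comp => //.
      exact: (measurableT_comp (measurable_payoff_at_Theta mh) (pair2_measurable u)).
    - by move=> w _; rewrite lee_fin; exact: h'le.
  apply: ereal_sup_ubound; exists (fun j => Theta (p j) (tnth u j)) => // j.
  exact: (stopping_time_Theta F_usual).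
apply: (@le_lt_trans _ _ (\int[lebn N]_(u in @unit_cube R N) cst C u)%E).
  apply: ge0_le_integral => //.
  - by move=> u _; apply: integral_ge0 => w _; rewrite lee_fin; exact: h'0.
  - by apply: measurable_funTS; exact: measurable_expected_payoff.
by rewrite integral_cst// [X in (_ * X)%E]lebesgue_measure_unit_cube mule1.
Qed.

Lemma integral_gN_Theta_path h w : measurable_payoff h i ->
  (\int[lebesgue_stieltjes_measure (rs_path (p i) w)]_(t in `[0%R, +oo[)
     (gN h (X t w) t (fun j : others i => p (val j) t w))%:E =
   \int[leb]_(u in `[0%R, 1%R]) (gN_Theta h (w, u))%:E)%E.
Proof.
move=> mh; rewrite (integral_Theta F_usual)//.
apply/measurable_EFinP.
(* Sampling requires a time that is nonnegative everywhere; the truncation agrees with [t] on [[0,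
   +oo[]. *)
pose tau (t : mR) : R := Num.max t 0.
have tau0 t : 0 <= tau t by rewrite le_max lexx orbT.
have mtau : measurable_fun setT tau by exact: measurable_maxr.
apply: (eq_measurable_fun (fun t : mR => gN h (X (tau t) w) (tau t)
    (fun j : others i => p (val j) (tau t) w))).
  by move=> t; rewrite inE/= in_itv/= andbT => t0; rewrite /tau max_l.
apply: measurable_funTS; apply: (measurable_gN (v := cst w)) => // j.
exact: (measurable_rs_at (v := cst w)).
Qed.

End representation.

(** * Signed payoffs, by positive and negative parts *)

Theorem proposition3p1 (R : realType) (N d : nat)
  (d0 : measure_display) (Omega : measurableType d0) (P : probability Omega R)
  (F : R -> set (set Omega))
  (X : R -> Omega -> d.-tuple (measurableTypeR R))
  (h : forall i : 'I_N,
     d.-tuple (measurableTypeR R) -> R -> {ffun others i -> bool} -> R)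
  (N_ge2 : (2 <= N)%N)
  (F_usual : usual_conditions P F)
  (X_measurable : forall t, 0 <= t -> measurable_fun [set: Omega] (X t))
  (X_continuous : forall w (k : 'I_d),
     {within [set` `[0, +oo[], continuous (fun t : R => tnth (X t w) k : R)})
  (F_generated : generated_by P X F)
  (h_measurable : forall i, measurable_payoff h i)
  (h_bounded : forall i, payoff_bounded P X h F i)
  (p : 'I_N -> randomized_stopping F) (i : 'I_N) :
  JR P X h p i =
  (\int[P]_w \int[lebesgue_stieltjes_measure (rs_path (p i) w)]_(t in `[0%R, +oo[)
     (gN h (X t w) t (fun j : others i => p (val j) t w))%:E)%E.
Proof.
have mh := h_measurable i; have hb := h_bounded i.
pose hp k x t (a : {ffun others k -> bool}) := Num.max (h k x t a) 0.
pose hn k x t (a : {ffun others k -> bool}) := Num.max (- h k x t a) 0.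
have mhp : measurable_payoff hp i by move=> a; apply: measurable_maxr; [exact: mh|].
have mhn : measurable_payoff hn i.
  by move=> a; apply: measurable_maxr => //; apply: measurableT_comp => //; exact: mh.
have hp0 x t a : 0 <= hp i x t a by rewrite le_max lexx orbT.
have hn0 x t a : 0 <= hn i x t a by rewrite le_max lexx orbT.
have hpn x t a : h i x t a = hp i x t a - hn i x t a.
  rewrite /hp /hn; case: (leP 0 (h i x t a)) => h0.
    by rewrite max_r ?subr0// oppr_le0.
  by rewrite max_l ?opprK ?add0r// oppr_ge0 ltW.
have hp_le x t a : 0 <= hp i x t a <= `|h i x t a|.
  by rewrite hp0 ge_max ler_norm normr_ge0.
have hn_le x t a : 0 <= hn i x t a <= `|h i x t a|.
  by rewrite hn0 ge_max -normrN ler_norm normr_ge0.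
have mcube := @measurable_unit_cube R N.
pose K k (u : N.-tuple (measurableTypeR R)) : \bar R :=
  (\int[P]_w (payoff_at X k i (fun j => Theta (p j) (tnth u j)) w)%:E)%E.
have iK k : measurable_payoff k i -> (forall x t a, 0 <= k i x t a <= `|h i x t a|) ->
    (lebesgue_measure_tuple R N).-integrable (@unit_cube R N) (K k).
  move=> mk kh; have k0 x t a : 0 <= k i x t a by have /andP[] := kh x t a.
  apply/integrableP; split.
    by apply: measurable_funTS; exact: (measurable_expected_payoff F_usual).
  under eq_integral.
    by move=> u _; rewrite gee0_abs; [over|apply: integral_ge0 => w _; exact: k0].
  exact: (integral_expected_payoff_lty F_usual X_measurable X_continuous _ mh hb).
(* The local integrand is carried to the product of [Omega] with the level [u], with the indicator
   of [[0, 1]] as a factor. *)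
pose L k (z : Omega * measurableTypeR R) : \bar R :=
  (\1_`[0%R, 1%R] z.2 * gN k (X (Theta (p i) z.2 z.1) z.1) (Theta (p i) z.2 z.1)
     (fun j : others i => p (val j) (Theta (p i) z.2 z.1) z.1))%:E.
have mL k : measurable_payoff k i -> measurable_fun setT (L k).
  move=> mk; apply/measurable_EFinP; apply: measurable_funM.
    by apply: measurableT_comp => //; exact: measurable_indic.
  exact: (measurable_gN_Theta F_usual).
have LE k w : (\int[lebesgue_measure]_u L k (w, u) =
    \int[lebesgue_measure]_(u in `[0%R, 1%R]) (gN k (X (Theta (p i) u w) w) (Theta (p i) u w)
     (fun j : others i => p (val j) (Theta (p i) u w) w))%:E)%E.
  by rewrite [RHS]integral_mkcond; apply: eq_integral => u _; rewrite restrict_EFin_indic.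
have L0 k z : (forall x t a, 0 <= k i x t a) -> (0 <= L k z)%E.
  move=> k0; rewrite lee_fin mulr_ge0 ?indicE// gN_ge0// => j.
  exact/rs_range/Theta_ge0.
have intL k : measurable_payoff k i -> (forall x t a, 0 <= k i x t a) ->
    (\int[P \x lebesgue_measure]_z L k z =
     \int[lebesgue_measure_tuple R N]_(u in @unit_cube R N) K k u)%E.
  move=> mk k0; rewrite fubini_tonelli1; [|exact: mL|by move=> z; exact: L0].
  rewrite (integral_randomized_payoff F_usual X_measurable X_continuous)//.
  by apply: eq_integral => w _; exact: LE.
(* For a nonnegative payoff [intL] equates the integral of [L k] with that over the cube, so
   finiteness is inherited from the bound on expected payoffs. *)
have iL k : measurable_payoff k i -> (forall x t a, 0 <= k i x t a <= `|h i x t a|) ->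
    (P \x lebesgue_measure)%E.-integrable setT (L k).
  move=> mk kh; have k0 x t a : 0 <= k i x t a by have /andP[] := kh x t a.
  apply/integrableP; split; first exact: mL.
  under eq_integral do rewrite gee0_abs ?L0//.
  rewrite intL//.
  exact: (integral_expected_payoff_lty F_usual X_measurable X_continuous _ mh hb).
have LB z : L h z = (L hp z - L hn z)%E.
  rewrite /L -EFinB -mulrBr; congr (_ * _)%:E.
  by rewrite /gN -sumrB; apply: eq_bigr => a _; rewrite hpn mulrBl.
(* The expectation is by definition the difference of those of the positive and negative parts,
   which are the payoffs of [hp] and [hn]. *)
transitivity (\int[lebesgue_measure_tuple R N]_(u in @unit_cube R N) (K hp u - K hn u))%E.
  apply: eq_integral => u _; rewrite /J unlock integralE; congr (_ - _)%E.
    by apply: eq_integral => w _; rewrite funeposE /= -EFin_max.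
  by apply: eq_integral => w _; rewrite funenegE /= -EFin_max.
rewrite integralB//; [|exact: iK|exact: iK].
rewrite -intL// -intL// -integralB//; [|exact: iL|exact: iL].
under eq_integral do rewrite -LB.
(* Fubini for the signed [L h], integrable as the difference of two integrable functions, restores
   the integral over [Omega] outside and that over the level inside. *)
rewrite -integral12_prod_meas1; last first.
  rewrite (_ : L h = (L hp \- L hn)%E); last exact/funext.
  by apply: integrableB => //; exact: iL.
apply: eq_integral => w _; rewrite /fubini_F LE.
by rewrite (integral_gN_Theta_path F_usual X_measurable X_continuous).
Qed.
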